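(* Let $\mu$ be a Borel probability measure on $\mathbb{R}$ and let $\epsilon>0$. Then $$\lim_{n\to\infty} n\, d_{\epsilon}(\mu,\delta_{\bullet}^{\bullet,n}) = \epsilon\int_{\mathbb{R}} \Omega\!\left(\frac1\epsilon\cdot\frac{\mathrm{d}\mu_{\sf A}}{\mathrm{d}\lambda}\right)\mathrm{d}\lambda .$$
   Context: $\mathbb{R}^+$ denotes the positive reals, and $\lambda$ is Lebesgue measure on $\mathbb{R}$. For a Borel probability measure $\mu$ on $\mathbb{R}$ let $F_\mu(x)=\mu((-\infty,x])$ and $F_{\mu-}(x)=\mu((-\infty,x))$. For $\epsilon>0$ the $\epsilon$-Lévy metric is $$d_\epsilon(\mu,\nu)=\inf\{y\in\mathbb{R}^+ : F_{\mu-}(x-y/\epsilon)-y\le F_\nu(x)\le F_\mu(x+y/\epsilon)+y \text{ for all } x\in\mathbb{R}\}.$$ Best approximation: for $n\in\mathbb{N}=\{1,2,\ldots\}$ let $\Xi_n=\{x\in\mathbb{R}^n: x_{,1}\le\ldots\le x_{,n}\}$, $\Pi_n=\{p\in\mathbb{R}^n:p_{,j}\ge0,\ \sum_{j=1}^np_{,j}=1\}$, and $\delta_x^p=\sum_{j=1}^np_{,j}\delta_{x_{,j}}$ for $x\in\Xi_n$, $p\in\Pi_n$, where $\delta_a$ is the unit point mass at $a$. The symbol $\delta_\bullet^{\bullet,n}$ denotes any best $d_\epsilon$-approximation of $\mu$, that is, any $\delta_x^p$ with $x\in\Xi_n$, $p\in\Pi_n$ such that $d_\epsilon(\mu,\delta_x^p)\le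 d_\epsilon(\mu,\delta_y^q)$ for all $y\in\Xi_n$, $q\in\Pi_n$ (such a minimizer exists); thus $d_\epsilon(\mu,\delta_\bullet^{\bullet,n})=\min_{x\in\Xi_n,\,p\in\Pi_n}d_\epsilon(\mu,\delta_x^p)$. $\mu=\mu_{\sf A}+\mu_{\sf S}$ is the Lebesgue decomposition of $\mu$, with $\mu_{\sf A}$ absolutely continuous and $\mu_{\sf S}$ singular with respect to $\lambda$. The function $\Omega:\mathbb{R}\to\mathbb{R}$ is $\Omega(x)=\dfrac{x}{2+2|x|}$. *)

(* Defs.v *)
From HB Require Import structures.
From mathcomp Require Import all_boot all_order all_algebra.
From mathcomp Require Import all_classical all_reals all_analysis.

Set Implicit Arguments.
Unset Strict Implicit.
Unset Printing Implicit Defensive.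

Import Order.TTheory GRing.Theory Num.Theory.
Import numFieldNormedType.Exports.

Local Open Scope classical_set_scope.
Local Open Scope ring_scope.

Section Distribution.
Context {R : realType}.
Implicit Types mu nu : probability (measurableTypeR R) R.

Definition cdf_right mu (x : R) : R := fine (mu `]-oo, x]%classic).

Definition cdf_left mu (x : R) : R := fine (mu `]-oo, x[%classic).

(* The set is nonempty (it contains 1) and bounded below by 0, so [inf] is its
   genuine infimum and not the default value. *)
Definition levy (eps : R) mu nu : R :=
  inf [set y : R | 0 < y /\
    forall x : R, cdf_left mu (x - y / eps) - y <= cdf_right nu x /\
                  cdf_right nu x <= cdf_right mu (x + y / eps) + y].

Definition Omega (x : R) : R := x / (2 + 2 * `|x|).

End Distribution.

Section PointMasses.
Context {R : realType}.

Definition Xi (n : nat) : set 'rV[R]_n :=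
  [set x | forall i j : 'I_n, (i <= j)%N -> x ord0 i <= x ord0 j].

Definition Pi (n : nat) : set 'rV[R]_n :=
  [set p | (forall j, 0 <= p ord0 j) /\ \sum_(j < n) p ord0 j = 1].

(* The membership proof is an argument so that the combination of point masses
   is a [probability] and not merely a set function. *)
Definition delta (n : nat) (x p : 'rV[R]_n) (hp : Pi p)
    (A : set (measurableTypeR R)) : \bar R :=
  (\sum_(j < n) (p ord0 j)%:E * \d_(x ord0 j) A)%E.

Lemma delta_semi_sigma_additive (n : nat) (x p : 'rV[R]_n) (hp : Pi p) :
  semi_sigma_additive (delta x hp).
Proof.
move: n x p hp => [|m] x p hp.
  by have /eqP := hp.2; rewrite big_ord0 eq_sym oner_eq0.
pose mj (k : nat) : {measure set (measurableTypeR R) -> \bar R} :=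
  mscale (NngNum (hp.1 (inord k))) (@dirac _ (measurableTypeR R) (x ord0 (inord k)) R).
have -> : delta x hp = msum mj m.+1.
  apply/funext => A; rewrite /delta /msum; apply: eq_bigr => j _.
  by rewrite /mj /= /mscale /= inord_val.
exact: measure_semi_sigma_additive.
Qed.

Section Instances.
Variables (n : nat) (x p : 'rV[R]_n) (hp : Pi p).

Let delta0 : delta x hp set0 = 0%E.
Proof. by rewrite /delta big1// => j _; rewrite measure0 mule0. Qed.

Let delta_ge0 A : (0 <= delta x hp A)%E.
Proof.
by apply: sume_ge0 => j _; rewrite mule_ge0// lee_fin; case: hp.
Qed.

Let delta_sigma_additive : semi_sigma_additive (delta x hp).
Proof. exact: delta_semi_sigma_additive. Qed.

HB.instance Definition _ := isMeasure.Build _ _ _ (delta x hp)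
  delta0 delta_ge0 delta_sigma_additive.

Let delta_setT : delta x hp setT = 1%E.
Proof.
rewrite /delta; case: hp => _ hp1.
under eq_bigr do rewrite diracT mule1.
by rewrite sumEFin hp1.
Qed.

HB.instance Definition _ :=
  Measure_isProbability.Build _ _ _ (delta x hp) delta_setT.

End Instances.

Definition best_approx (eps : R) (mu : probability (measurableTypeR R) R)
    (n : nat) (nu : probability (measurableTypeR R) R) : Prop :=
  exists (x p : 'rV[R]_n) (hp : Pi p),
    [/\ Xi x, nu = delta x hp
      & forall (y q : 'rV[R]_n) (hq : Pi q), Xi y ->
          levy eps mu nu <= levy eps mu (delta y hq)].

End PointMasses.

Definition mutually_singular (d : measure_display) (T : measurableType d)
    (R : realType) (m1 m2 : {measure set T -> \bar R}) : Prop :=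
  exists N : set T, [/\ measurable N, m1 (~` N) = 0%E & m2 N = 0%E].

Definition lebesgue_decomposition (R : realType)
    (mu : probability (measurableTypeR R) R)
    (muA muS : {finite_measure set (measurableTypeR R) -> \bar R}) : Prop :=
  [/\ forall B, measurable B -> mu B = (muA B + muS B)%E,
      muA `<< lebesgue_measure
    & mutually_singular muS lebesgue_measure].

(* Main.v *)
Require Import Defs.
From HB Require Import structures.
From mathcomp Require Import all_boot all_order all_algebra.
From mathcomp Require Import all_classical all_reals all_analysis.
From mathcomp Require Import measurable_realfun ring lra zify.

Set Implicit Arguments.
Unset Strict Implicit.
Unset Printing Implicit Defensive.

Import Order.TTheory GRing.Theory Num.Theory.
Import numFieldNormedType.Exports.

Local Open Scope classical_set_scope.
Local Open Scope ring_scope.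
Local Open Scope charge_scope.

(** The distribution function of [nu] is within distance [y] of [mu] when its
    graph stays in the band between [F_mu (x - y / eps) - y] (left limits) and
    [F_mu (x + y / eps) + y].  Put [eta = y / eps].  A horizontal piece of the
    graph over [[a, b)] fits into this band exactly when the lower edge at [b]
    is not above the upper edge at [a], that is, when
    [mu (]a + eta, b - eta[) <= 2 y]; the interval is then called bridgeable.
    So [d_eps] of the best [n]-point approximation is the smallest [y] for which
    the line, up to tails of mass [y], splits into about [n] bridgeable
    intervals, and the theorem counts how many of them are necessary.

    Write [ka] for [eps] times Lebesgue measure.  An interval [C] with shrunken
    interior [V] is subject to two constraints: [mu V <= 2 y], and
    [ka (C \ V) <= 2 y] because the two end pieces have length [eta] each.
    Hence [c mu V + (1 - c) ka (C \ V) <= 2 y] for all [c] in [[0, 1]], and all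
    these inequalities are reversed for an interval that is maximal among the
    bridgeable ones.  The right weight [c] is the one for which the left-hand
    side does not depend on [V]: if [w] satisfies [w dmu = (1 - w) dka], then
    the integral of [w dmu] over [V] plus that of [(1 - w) dka] over [C \ V] is
    the integral of [w dmu] over [C].  With [f] the density of the absolutely
    continuous part of [mu], such a [w] is [eps / (eps + f)], set to [0] on a
    null set that carries the singular part ([exists_balanced_weight]).

    If [w] were constant on each interval, every bridgeable interval would
    therefore carry at most [2 y] of the measure [w dmu], and the intervals of
    the greedy partition at least [2 y].  In general [w] is replaced by a step
    function with finitely many jumps, close to [w] in L1 of [mu + ka]
    ([step_approximation]); adding the jumps to the partition costs a number of
    intervals that does not depend on [y].  The two counts, [weight_oc_bound]
    and [greedy], yield [n d_n --> W / 2] with [W] the integral of [w dmu]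
    ([n_levy_cvg]); and [W = eps * \int (1 - w)
    = 2 eps * \int Omega (f / eps)]. *)

(** * Step functions approximate bounded functions in L1 *)

Lemma measure_vanishing d (T : measurableType d) (R : realType)
    (m : {measure set T -> \bar R}) (F : (set T)^nat) (e : R) :
  (m (F 0%N) < +oo)%E -> (forall n, measurable (F n)) ->
  \bigcap_n F n = set0 -> nonincreasing_seq F -> 0 < e ->
  exists n, (m (F n) <= e%:E)%E.
Proof.
move=> F0 mF Fset0 niF e0.
have : m \o F @ \oo --> 0%E.
  rewrite -(measure0 m) -Fset0; apply: nonincreasing_cvg_mu => //.
  by rewrite Fset0.
have e0' : (0 < e%:E)%E by rewrite lte_fin.
move=> /(_ _ (open_ereal_lt' e0'))[n _ /(_ n (leqnn _))/= Hn].
by exists n; exact: ltW.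
Qed.

(** Step functions are described by what they may depend on, namely the
    position of the argument relative to the breakpoints [ts].  Breakpoint lists
    can then be concatenated freely, with no sorting, and the definition applies
    to sets ([U = Prop]) as well as to real functions. *)
Definition step_on {R : realType} {U : Type} (ts : seq R) (g : R -> U) :=
  forall x y, (forall t, t \in ts -> (x <= t) = (y <= t)) -> g x = g y.

Section Step.
Context {R : realType}.
Notation T := (measurableTypeR R).

Let mY (X Y : set T) : measurable X -> measurable Y -> measurable (X `+` Y).
Proof.
by move=> mX mY; rewrite setY_def; apply: measurableU; exact: measurableD.
Qed.

Variables (rho : {measure set T -> \bar R}) (D : set T).
Hypotheses (mD : measurable D) (Dfin : (rho D < +oo)%E).

Definition interval_approximable (B : set T) := measurable B /\
  forall d : R, 0 < d -> exists (ts : seq R) (J : set T),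
    [/\ step_on ts J, measurable J & (rho (D `&` (B `+` J)) <= d%:E)%E].

Lemma interval_approximableC B :
  interval_approximable B -> interval_approximable (~` B).
Proof.
move=> [mB appB]; split; first exact: measurableC.
move=> d /appB[ts [J [Jts mJ rhoJ]]]; exists ts, (~` J); split.
- by move=> x y /Jts xy; rewrite /setC/= xy.
- exact: measurableC.
- rewrite (_ : ~` B `+` ~` J = B `+` J)//.
  by rewrite !setY_def !setDE !setCK setUC (setIC (~` J)) (setIC J).
Qed.

Lemma interval_approximableU A B : interval_approximable A ->
  interval_approximable B -> interval_approximable (A `|` B).
Proof.
move=> [mA appA] [mB appB]; split; first exact: measurableU.
move=> d d0; have d20 : 0 < d / 2 by rewrite divr_gt0.
have [ts [J [Jts mJ rhoJ]]] := appA _ d20.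
have [us [K [Kus mK rhoK]]] := appB _ d20.
exists (ts ++ us), (J `|` K); split.
- move=> x y xy; rewrite /setU/= (Jts _ y) ?(Kus _ y)// => t tin; apply: xy;
  by rewrite mem_cat tin ?orbT.
- exact: measurableU.
rewrite [d]splitr EFinD; apply: le_trans (leeD rhoJ rhoK).
apply: (@le_trans _ _ (rho ((D `&` (A `+` J)) `|` (D `&` (B `+` K))))).
  apply: le_measure; rewrite ?inE.
  - by apply: measurableI => //; apply: mY; exact: measurableU.
  - by apply: measurableU; apply: measurableI => //; exact: mY.
  move=> x [Dx]; rewrite !setY_def => -[[[Ax|Bx] /not_orP[nJ nK]]|].
  - by left; split => //; left.
  - by right; split => //; left.
  - move=> [[Jx|Kx] /not_orP[nA nB]].
    + by left; split => //; right.
    + by right; split => //; right.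
by apply: measureU2; apply: measurableI => //; exact: mY.
Qed.

(** Finite unions approximate the countable one since [rho D] is finite. *)
Lemma interval_approximable_bigcup (F : (set T)^nat) :
  (forall n, interval_approximable (F n)) ->
  interval_approximable (\bigcup_n F n).
Proof.
move=> appF; have mF n : measurable (F n) by case: (appF n).
split; first exact: bigcup_measurable.
move=> d d0; have d20 : 0 < d / 2 by rewrite divr_gt0.
pose G n := \big[setU/set0]_(i < n) F i.
have mG n : measurable (G n) by exact: bigsetU_measurable.
have appG n : interval_approximable (G n).
  elim: n => [|n ihn]; last first.
    by rewrite /G big_ord_recr/=; exact: interval_approximableU.
  rewrite /G big_ord0; split => // e e0; exists [::], set0; split => //.
  by rewrite setYK setI0 measure0 lee_fin ltW.
pose H n := D `&` ((\bigcup_n F n) `\` G n).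
have mH n : measurable (H n).
  by apply: measurableI => //; apply: measurableD => //; exact: bigcup_measurable.
have [n rhoH] : exists n, (rho (H n) <= (d / 2)%:E)%E.
  apply: measure_vanishing => //.
  - apply: le_lt_trans Dfin; apply: le_measure; rewrite ?inE//.
    exact: subIsetl.
  - apply/seteqP; split => // x Hx.
    have [_ [[k _ Fkx] _]] := Hx 0%N I.
    have [_ [_]] := Hx k.+1 I; apply.
    by rewrite /G big_ord_recr/=; right.
  - move=> m n mn; rewrite subsetEset => x [Dx [Fx nG]]; split => //; split => //.
    by move: nG; apply: contra_not => Gmx; exact: (@subset_bigsetU _ F _ _ mn _ Gmx).
have [_ /(_ _ d20)[ts [J [Jts mJ rhoJ]]]] := appG n.
exists ts, J; split => //.
rewrite [d]splitr EFinD; apply: le_trans (leeD rhoH rhoJ).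
apply: (@le_trans _ _ (rho ((H n) `|` (D `&` (G n `+` J))))).
  apply: le_measure; rewrite ?inE.
  - by apply: measurableI => //; apply: mY => //; exact: bigcup_measurable.
  - by apply: measurableU => //; apply: measurableI => //; exact: mY.
  move=> x [Dx]; rewrite !setY_def => -[[Fx nJ]|[Jx nF]].
  - have [Gx|nGx] := pselect (G n x).
    + by right; split => //; left.
    + by left.
  - right; split => //; right; split => //.
    by apply: contra_not nF; exact: bigsetU_bigcup.
by apply: measureU2 => //; apply: measurableI => //; exact: mY.
Qed.

(** The approximable sets form a sigma-algebra, which contains the half-open
    intervals and hence all Borel sets. *)
Lemma measurable_interval_approximable B :
  measurable B -> interval_approximable B.
Proof.
move: B; apply: smallest_sub.
  split.
  - split => // d d0; exists [::], set0; split => //.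
    by rewrite setYK setI0 measure0 lee_fin ltW.
  - by move=> A appA; rewrite setTD; exact: interval_approximableC.
  - exact: interval_approximable_bigcup.
move=> _ [[a b] _ <-]/=; split.
  exact: measurable_itv.
move=> d d0; exists [:: a; b], `]a, b]%classic; split.
- move=> x y xy; rewrite /= !in_itv/= !ltNge.
  by rewrite !xy ?inE ?eqxx ?orbT.
- exact: measurable_itv.
- by rewrite setYK setI0 measure0 lee_fin ltW.
Qed.

End Step.

(** The staircase is [floor t], written as a sum so that a function of values in
    [[0, 1]] is within [1 / m] of the average of the indicators of its [m]
    superlevel sets. *)
Lemma staircase_bounds (R : realType) (m : nat) (t : R) : 0 <= t <= m%:R ->
  t - 1 <= \sum_(i < m) (i.+1%:R <= t)%R%:R <= t.
Proof.
elim: m => [|m ihm] /andP[t0 tm].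
  by rewrite big_ord0 t0 andbT; have := tm; rewrite /=; lra.
rewrite big_ord_recr/=; have [tm'|tm'] := leP t m%:R.
  rewrite (_ : (_ <= t) = false) ?addr0; first by apply: ihm; rewrite t0.
  by apply/negbTE; rewrite -ltNge -natr1; lra.
rewrite (eq_bigr (fun=> 1)) => [|i _]; last first.
  by rewrite (le_trans _ (ltW tm'))// ler_nat ltn_ord.
rewrite sumr_const card_ord; move: tm; rewrite -natr1 => tm.
have [mt|mt] := leP (m%:R + 1) t; rewrite /= ?mulr1n ?mulr0n;
  by apply/andP; split; lra.
Qed.

Section StepApproximation.
Context {R : realType}.
Notation T := (measurableTypeR R).

(** Replacing in the average of superlevel indicators each superlevel set by an
    approximating finite union of intervals gives a step function, still with
    values in [[0, 1]]. *)
Lemma step_approximation_on (rho : {measure set T -> \bar R}) (D : set T)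
    (w : T -> R) (d : R) :
  measurable D -> (rho D < +oo)%E ->
  measurable_fun setT w -> (forall x, 0 <= w x <= 1) -> 0 < d ->
  exists (ts : seq R) (g : T -> R),
    [/\ step_on ts g, measurable_fun setT g, forall x, 0 <= g x <= 1 &
      (\int[rho]_(x in D) `|w x - g x|%:E <= d%:E)%E].
Proof.
move=> mD Dfin mw w01 d0.
pose r := fine (rho D).
have rE : rho D = r%:E by rewrite /r fineK// ge0_fin_numE.
have r0 : 0 <= r by exact: fine_ge0.
(* The staircase error [1 / m] is to contribute at most half of [d]. *)
pose m := (Num.truncn (r / (d / 2))).+1.
have rm : r / m%:R <= d / 2.
  rewrite ler_pdivrMr// -ler_pdivrMl ?divr_gt0// mulrC ltW//.
  by rewrite /m; exact: truncnS_gt.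
pose B i := [set x | i.+1%:R <= m%:R * w x].
have mB i : measurable (B i : set T).
  rewrite -[B i]setTI; apply: measurable_fun_le => //.
  exact: measurable_funM.
have d20 : 0 < d / 2 by rewrite divr_gt0.
have /choice[ts /choice[J JP]] : forall i, exists us (K : set T),
    [/\ step_on us K, measurable K & (rho (D `&` (B i `+` K)) <= (d / 2)%:E)%E].
  by move=> i; have [_] := measurable_interval_approximable mD Dfin (mB i); apply.
have mJ i : measurable (J i) by case: (JP i).
have mY i : measurable (B i `+` J i).
  by rewrite setY_def; apply: measurableU; exact: measurableD.
pose g x := m%:R^-1 * \sum_(i < m) \1_(J i) x : R.
have m0 : 0 < m%:R :> R by [].
exists (flatten [seq ts i | i <- iota 0 m]), g; split.
- move=> x y xy; congr (_ * _); apply: eq_bigr => i _.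
  rewrite !indicE; congr (_%:R); congr nat_of_bool.
  have [Jts _ _] := JP i.
  have JE : J i x = J i y.
    apply: Jts => t tin; apply: xy; apply/flatten_mapP.
    by exists (nat_of_ord i) => //; rewrite mem_iota/= add0n ltn_ord.
  by apply/idP/idP; rewrite !inE JE.
- apply: measurable_funM => //; apply: measurable_sum => i.
  exact: measurable_indic.
- move=> x; apply/andP; split.
    by rewrite mulr_ge0 ?invr_ge0// sumr_ge0// => i _; rewrite indicE.
  rewrite ler_pdivrMl// mulr1.
  apply: (@le_trans _ _ (\sum_(i < m) 1)); last by rewrite sumr_const card_ord.
  by apply: ler_sum => i _; rewrite indicE; case: (_ \in _).
have -> : d%:E = ((d / 2)%:E + m%:R^-1%:E * \sum_(i < m) (d / 2)%:E)%E.
  rewrite sumEFin sumr_const card_ord -EFinM -EFinD; congr EFin.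
  by rewrite -[d / 2 *+ m]mulr_natl mulKf ?gt_eqF// -splitr.
pose h (x : T) : \bar R := (m%:R^-1%:E +
  m%:R^-1%:E * \sum_(i < m) (\1_(B i `+` J i) x : R)%:E)%E.
have h0 x : (0 <= h x)%E.
  by rewrite /h sumEFin -EFinM -EFinD lee_fin addr_ge0 ?mulr_ge0 ?invr_ge0//
     sumr_ge0// => i _; rewrite indicE.
have m1 : measurable_fun D (fun x => \sum_(i < m) (\1_(B i `+` J i) x : R)%:E)%E.
  apply: emeasurable_sum => i.
  by apply/measurable_EFinP/measurable_funTS; exact: measurable_indic.
have s0 x : (0 <= \sum_(i < m) (\1_(B i `+` J i) x : R)%:E)%E.
  by apply: sume_ge0 => i _; rewrite lee_fin indicE.
have m2 : measurable_fun D
    (fun x => m%:R^-1%:E * \sum_(i < m) (\1_(B i `+` J i) x : R)%:E)%E.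
  exact: measurable_funeM.
apply: (@le_trans _ _ (\int[rho]_(x in D) h x)%E).
  apply: ge0_le_integral => //.
  - apply/measurable_EFinP/measurable_funTS/measurableT_comp => //.
    apply: measurable_funB => //; apply: measurable_funM => //.
    by apply: measurable_sum => i; exact: measurable_indic.
  - exact: emeasurable_funD.
  move=> x Dx; rewrite /h sumEFin -EFinM -EFinD lee_fin /g.
  have /andP[s1 s2] : m%:R * w x - 1 <= \sum_(i < m) \1_(B i) x <= m%:R * w x.
    under eq_bigr do rewrite indicE mem_setE.
    apply: staircase_bounds; have /andP[wx0 wx1] := w01 x.
    by rewrite mulr_ge0//= ler_piMr.
  rewrite -(ler_pM2l m0) mulrDr !mulVKf ?gt_eqF// -[X in X * `|_|]gtr0_norm//.
  rewrite -normrM mulrBr mulVKf ?gt_eqF// divff ?gt_eqF//.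
  rewrite -(subrKA (\sum_(i < m) \1_(B i) x)).
  apply: le_trans (ler_normD _ _) _; apply: lerD.
    by rewrite ger0_norm; lra.
  rewrite -sumrB; apply: le_trans (ler_norm_sum _ _ _) _.
  apply: ler_sum => i _; rewrite !indicE setY_def in_setU !in_setD.
  by case: (_ \in _); case: (_ \in _);
    rewrite /= ?subrr ?subr0 ?sub0r ?normrN ?normr0 ?normr1.
rewrite ge0_integralD//; last first.
  by move=> x _; rewrite mule_ge0// lee_fin invr_ge0.
apply: leeD.
  rewrite integral_cst// rE -EFinM lee_fin mulrC.
  exact: rm.
rewrite ge0_integralZl_EFin// ?invr_ge0//.
apply: lee_wpmul2l; first by rewrite lee_fin invr_ge0.
rewrite ge0_integral_sum//; last first.
  by move=> i; apply/measurable_EFinP/measurable_funTS; exact: measurable_indic.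
apply: lee_sum => i _; rewrite integral_indic// setIC.
by case: (JP i).
Qed.
End StepApproximation.

(** * Weights balancing a probability measure against a measure of length *)

Lemma probability_tail (R : realType)
    (mu : probability (measurableTypeR R) R) (d : R) : 0 < d ->
  exists M : R, 0 < M /\ (mu (~` `](- M)%R, M]%classic) <= d%:E)%E.
Proof.
move=> d0; pose I (n : nat) : set (measurableTypeR R) :=
  `]- n.+1%:R, n.+1%:R]%classic.
have mI n : measurable (I n) by exact: measurable_itv.
suff [n tail] : exists n, (mu (~` I n) <= d%:E)%E by exists n.+1%:R.
apply: measure_vanishing => //.
- by rewrite (le_lt_trans (probability_le1 _ _)) ?ltry//; exact: measurableC.
- by move=> n; exact: measurableC.
- rewrite -setC_bigcup (_ : \bigcup_n I n = setT) ?setCT//.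
  apply/seteqP; split => // x _; exists (Num.truncn `|x|) => //.
  have := truncnS_gt `|x|; rewrite ltr_norml => /andP[? ?].
  by rewrite /I/= in_itv/=; apply/andP; split => //; exact: ltW.
- move=> k m km; rewrite subsetEset; apply: subsetC => x.
  have : (k.+1%:R <= m.+1%:R :> R) by rewrite ler_nat.
  rewrite /I/= !in_itv/= => km' /andP[? ?].
  by apply/andP; split; lra.
Qed.

(** The weight [w] equalizes [w dmu] and [(1 - w) dka].  It is the price per unit
    of [mu]-mass for which covering a set by mass costs as much as covering it
    by length. *)
Section Balance.
Context {R : realType}.
Notation T := (measurableTypeR R).
Variables (mu : probability T R) (ka : {measure set T -> \bar R}) (w : T -> R).
Hypothesis ka_fin : forall a b : R, (ka `]a, b]%classic < +oo)%E.
Hypothesis mw : measurable_fun setT w.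
Hypothesis w01 : forall x, 0 <= w x <= 1.
Hypothesis balance : forall B : set T, measurable B ->
  (\int[mu]_(x in B) (w x)%:E = \int[ka]_(x in B) (1 - w x)%:E)%E.

Definition approx_error (g : T -> R) (B : set T) : \bar R :=
  (\int[mu]_(x in B) `|w x - g x|%:E + \int[ka]_(x in B) `|w x - g x|%:E)%E.

Let w0 x : (0 <= (w x)%:E)%E.
Proof. by rewrite lee_fin; case/andP: (w01 x). Qed.

Let w1 x : (0 <= (1 - w x)%:E)%E.
Proof. by rewrite lee_fin subr_ge0; case/andP: (w01 x). Qed.

Let mw' (B : set T) : measurable_fun B (fun x => (w x)%:E).
Proof. exact/measurable_EFinP/measurable_funTS. Qed.

Let mw1 (B : set T) : measurable_fun B (fun x => (1 - w x)%:E).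
Proof. by apply/measurable_EFinP/measurable_funTS; exact: measurable_funB. Qed.

Let me (g : T -> R) (B : set T) : measurable_fun setT g ->
  measurable_fun B (fun x => `|w x - g x|%:E).
Proof.
move=> mg; apply/measurable_EFinP/measurable_funTS/measurableT_comp => //.
exact: measurable_funB.
Qed.

Lemma approx_errorU (g : T -> R) (A B : set T) : measurable_fun setT g ->
  measurable A -> measurable B -> [disjoint A & B] ->
  approx_error g (A `|` B) = (approx_error g A + approx_error g B)%E.
Proof.
move=> mg mA mB AB; rewrite /approx_error !ge0_integral_setU//; last 2 first.
- exact: me.
- exact: me.
by rewrite addeACA.
Qed.

Lemma approx_error_ge0 (g : T -> R) (B : set T) : (0 <= approx_error g B)%E.
Proof. by apply: adde_ge0; exact: integral_ge0. Qed.

Lemma le_approx_error (g : T -> R) (A B : set T) : measurable_fun setT g ->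
  measurable A -> measurable B -> A `<=` B ->
  (approx_error g A <= approx_error g B)%E.
Proof.
move=> mg mA mB AB; apply: leeD; apply: ge0_subset_integral => //; exact: me.
Qed.

(** Outside a large interval [I] the step function is taken to be [1]: by balance
    the error there is the integral of [(1 - w) dmu + (1 - w) dka
    = (1 - w) dmu + w dmu], that is, the mass of the complement of [I], although
    [ka] may be infinite. *)
Lemma step_approximation (d : R) : 0 < d ->
  exists (ts : seq R) (g : T -> R),
    [/\ step_on ts g, measurable_fun setT g, forall x, 0 <= g x <= 1 &
      (approx_error g setT <= d%:E)%E].
Proof.
move=> d0; have d20 : 0 < d / 2 by rewrite divr_gt0.
have [M [M0 tail]] := probability_tail mu d20.
pose I : set T := `]- M, M]%classic.
have mI : measurable I by exact: measurable_itv.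
pose rho := measure_add mu ka.
have rhofin : (rho (I) < +oo)%E.
  rewrite /rho measure_addE lte_add_pinfty//; last exact: ka_fin.
  by rewrite (le_lt_trans (probability_le1 _ _)) ?ltry.
have [ts [g [gts mg g01 gd]]] := step_approximation_on (mI) rhofin mw w01 d20.
pose h (x : T) : R := if x \in I then g x else 1.
have mh : measurable_fun setT h.
  apply: measurable_fun_ifT => //; apply: (measurable_fun_bool true).
  by rewrite setTI (_ : _ @^-1` _ = I)//; apply/seteqP; split => x;
    [exact: set_mem|exact: mem_set].
exists [:: - M, M & ts], h; split => //.
- move=> x y xy; rewrite /h.
  have -> : (x \in I) = (y \in I).
    apply/idP/idP; rewrite !inE /I/= !in_itv/= !ltNge !xy ?inE ?eqxx ?orbT//.
  case: ifP => // _; apply: gts => t tin; apply: xy.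
  by rewrite !inE tin !orbT.
- by move=> x; rewrite /h; case: ifP => // _; rewrite ler01 lexx.
rewrite -(setUv (I)) approx_errorU//; last 2 first.
- exact: measurableC.
- by rewrite disj_set2E setICr.
rewrite [d]splitr EFinD; apply: leeD.
  rewrite /approx_error.
  apply: le_trans gd; rewrite ge0_integral_measure_add//; last exact: me.
  by apply: leeD; rewrite le_eqVlt; apply/orP; left; apply/eqP;
    apply: eq_integral => x xI; rewrite /h xI.
apply: le_trans tail; rewrite /approx_error.
have out (m : {measure set T -> \bar R}) :
    (\int[m]_(x in ~` I) `|w x - h x|%:E =
     \int[m]_(x in ~` I) (1 - w x)%:E)%E.
  apply: eq_integral => x; rewrite in_setC => /negbTE xI.
  by rewrite /h xI distrC ger0_norm// -lee_fin.
rewrite !out -balance; last exact: measurableC.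
rewrite -ge0_integralD//; last exact: measurableC.
under eq_integral do rewrite -EFinD subrK.
by rewrite integral_cst ?mul1e//; exact: measurableC.
Qed.

(** On a cell [C] where [g] is a constant [c], compare [c mu V + (1 - c) ka (C \ V)]
    with the integral of [w dmu] over [C], which by balance is the integral of
    [w dmu] over [V] plus that of [(1 - w) dka] over the rest. *)
Section Cell.
Variables (g : T -> R) (C V : set T) (c : R).
Hypotheses (mg : measurable_fun setT g) (mC : measurable C) (mV : measurable V).
Hypotheses (VC : V `<=` C) (c01 : 0 <= c <= 1) (gC : forall x, C x -> g x = c).

Let c0 : 0 <= c. Proof. by case/andP: c01. Qed.
Let c1 : 0 <= 1 - c. Proof. by rewrite subr_ge0; case/andP: c01. Qed.
Let mCV : measurable (C `\` V). Proof. exact: measurableD. Qed.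

Let mass_split : (\int[mu]_(x in C) (w x)%:E =
  \int[mu]_(x in V) (w x)%:E + \int[ka]_(x in C `\` V) (1 - w x)%:E)%E.
Proof.
rewrite -balance// -ge0_integral_setU//; first by rewrite setDUK.
by rewrite disj_set2E setDIK.
Qed.

Let error_split : (\int[mu]_(x in V) `|w x - g x|%:E +
  \int[ka]_(x in C `\` V) `|w x - g x|%:E <= approx_error g C)%E.
Proof. by apply: leeD; apply: ge0_subset_integral => //; exact: me. Qed.

Let const_split (z : R) : z%:E = (c%:E * z%:E + (1 - c)%:E * z%:E)%E.
Proof. by rewrite -!EFinM -EFinD; congr EFin; ring. Qed.

Lemma le_cell_mass (z : R) : (z%:E <= mu V)%E -> (z%:E <= ka (C `\` V))%E ->
  (z%:E <= \int[mu]_(x in C) (w x)%:E + approx_error g C)%E.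
Proof.
move=> zV zCV; rewrite mass_split.
apply: le_trans (leeD2l _ error_split); rewrite addeACA const_split.
apply: leeD.
- apply: (@le_trans _ _ (c%:E * mu V)%E); first by rewrite lee_wpmul2l.
  rewrite -integral_cst// -ge0_integralD//; last exact: me.
  apply: ge0_le_integral => //; first by apply: emeasurable_funD => //; exact: me.
  move=> x /VC/gC gx; rewrite -EFinD lee_fin gx.
  by have := ler_norm (c - w x); rewrite distrC; lra.
- apply: (@le_trans _ _ ((1 - c)%:E * ka (C `\` V))%E).
    by rewrite lee_wpmul2l.
  rewrite -integral_cst// -ge0_integralD//; last exact: me.
  apply: ge0_le_integral => //; first by apply: emeasurable_funD => //; exact: me.
  move=> x [/gC gx _]; rewrite -EFinD lee_fin gx.
  by have := ler_norm (w x - c); lra.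
Qed.

Lemma cell_mass_le (z : R) : (mu V <= z%:E)%E -> (ka (C `\` V) <= z%:E)%E ->
  (\int[mu]_(x in C) (w x)%:E <= z%:E + approx_error g C)%E.
Proof.
move=> zV zCV; rewrite mass_split.
apply: le_trans (leeD2l _ error_split); rewrite addeACA const_split addeACA.
rewrite [leRHS]addeACA.
apply: leeD.
- apply: (@le_trans _ _ (c%:E * mu V + \int[mu]_(x in V) `|w x - g x|%:E)%E);
    last by rewrite leeD2r// lee_wpmul2l.
  rewrite -integral_cst// -ge0_integralD//; last exact: me.
  apply: ge0_le_integral => //; first by apply: emeasurable_funD => //; exact: me.
  move=> x /VC/gC gx; rewrite -EFinD lee_fin gx.
  by have := ler_norm (w x - c); lra.
- apply: (@le_trans _ _ ((1 - c)%:E * ka (C `\` V) +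
    \int[ka]_(x in C `\` V) `|w x - g x|%:E)%E);
    last by rewrite leeD2r// lee_wpmul2l.
  rewrite -integral_cst// -ge0_integralD//; last exact: me.
  apply: ge0_le_integral => //; first by apply: emeasurable_funD => //; exact: me.
  move=> x [/gC gx _]; rewrite -EFinD lee_fin gx.
  by have := ler_norm (c - w x); rewrite distrC; lra.
Qed.

End Cell.
End Balance.

(** * Counting bridgeable intervals *)

(** Cutting [[a, b]] at the breakpoints inside it leaves at most [size ts + 1]
    pieces; [Q k a b] is any property that is additive over adjacent intervals
    and gets weaker as the count [k] grows. *)
Lemma breakpoint_ind (R : realType) (ts : seq R) (Q : nat -> R -> R -> Prop) :
  (forall a b, a < b -> (forall t, t \in ts -> ~~ (a < t < b)) -> Q 1%N a b) ->
  (forall m n a b c, a < b -> b < c -> Q m a b -> Q n b c -> Q (m + n)%N a c) ->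
  (forall m n a b, (m <= n)%N -> Q m a b -> Q n a b) ->
  forall a b, a < b -> Q (size ts).+1 a b.
Proof.
move=> Q1 QD Qle.
pose inner a b := count (fun t => a < t < b) ts.
suff Qcount k a b : (inner a b <= k)%N -> a < b -> Q (inner a b).+1 a b.
  move=> a b ab; apply: Qle (Qcount _ _ _ (leqnn _) ab).
  by rewrite ltnS; exact: count_size.
elim: k a b => [|k ihk] a b abk ab.
all: have [/hasP[t tts /andP[at_ tb]]|/hasPn none] :=
  boolP (has (fun t => a < t < b) ts); last first.
- by apply: Qle (Q1 _ _ ab none).
- by move: abk; rewrite leqn0 => /eqP/eqP; rewrite -leqn0 leqNgt -has_count;
    move=> /negP[]; apply/hasP; exists t => //; apply/andP.
- by apply: Qle (Q1 _ _ ab none).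
have split3 : (inner a t + inner t b < inner a b)%N.
  rewrite /inner; elim: ts tts {Q1 Qle QD ihk abk inner} => // u us ihu.
  have mono : (count (fun t0 => a < t0 < t)%R us + count (fun t0 => t < t0 < b)%R us
      <= count (fun t0 => a < t0 < b)%R us)%N.
    elim: us {ihu} => //= v us ihv.
    have [av|va] := ltP a v; have [vt|tv] := ltP v t;
      have [tv'|vt'] := ltP t v; have [vb|bv] := ltP v b; rewrite /=; (try lra); try lia.
  rewrite inE => /predU1P[<-|/ihu] /=.
    by rewrite !ltxx ?andbF at_ tb !add0n /= add1n ltnS.
  have [av|va] := ltP a u; have [vt|tv] := ltP u t;
    have [tv'|vt'] := ltP t u; have [vb|bv] := ltP u b; rewrite /=; (try lra); try lia.
apply: (@Qle ((inner a t).+1 + (inner t b).+1)%N); first by lia.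
by apply: (QD _ _ _ t) => //; apply: ihk => //; lia.
Qed.

Section Chains.
Context {R : realType}.
Notation T := (measurableTypeR R).
Variables (mu : probability T R) (eps : R) (heps : 0 < eps) (w : T -> R).

(** With this normalization a segment of length [y / eps] has measure [y], so that
    mass and length are measured in the same unit. *)
Definition eps_lebesgue : {measure set T -> \bar R} :=
  mscale (NngNum (ltW heps)) (@lebesgue_measure R).

Lemma eps_lebesgueE (A : set T) :
  eps_lebesgue A = (eps%:E * lebesgue_measure A)%E.
Proof. by []. Qed.

Lemma eps_lebesgue_itv (bl br : bool) (a b : R) : a <= b ->
  eps_lebesgue [set` Interval (BSide bl a) (BSide br b)] = (eps * (b - a))%:E.
Proof.
move=> ab; rewrite eps_lebesgueE lebesgue_measure_itv/= lte_fin.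
have [ltab|geab] := ltP a b; first by rewrite EFinM EFinB.
by rewrite mule0 (_ : b - a = 0) ?mulr0//; lra.
Qed.

Lemma eps_lebesgue_fin (a b : R) : (eps_lebesgue `]a, b]%classic < +oo)%E.
Proof.
rewrite eps_lebesgueE lebesgue_measure_itv/=; case: ifP => _.
  by rewrite -EFinB -EFinM ltry.
by rewrite mule0 ltry.
Qed.

Lemma eps_lebesgueD (a b u v : R) : a <= u -> u <= v -> v <= b ->
  eps_lebesgue (`]a, b] `\` `]u, v[)%classic = (eps * (b - a - (v - u)))%:E.
Proof.
move=> au uv vb; rewrite measureD//=.
- rewrite setIidr; last first.
    move=> x; rewrite /= !in_itv/= => /andP[? ?].
    by apply/andP; split; lra.
  rewrite (eps_lebesgue_itv false true)//.
  rewrite (eps_lebesgue_itv false false); last by lra.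
  by rewrite -EFinB [in RHS]mulrBr.
- by rewrite (eps_lebesgue_itv false false) ?ltry//; lra.
Qed.

Hypothesis mw : measurable_fun setT w.
Hypothesis w01 : forall x, 0 <= w x <= 1.
Hypothesis balance : forall B : set T, measurable B ->
  (\int[mu]_(x in B) (w x)%:E = \int[eps_lebesgue]_(x in B) (1 - w x)%:E)%E.

Variables (ts : seq R) (g : T -> R).
Hypotheses (gts : step_on ts g) (mg : measurable_fun setT g).
Hypothesis g01 : forall x, 0 <= g x <= 1.

Definition weight_oc (a b : R) : \bar R := (\int[mu]_(x in `]a, b]) (w x)%:E)%E.

Definition error_oc (a b : R) : \bar R :=
  approx_error mu eps_lebesgue w g `]a, b]%classic.

Definition shrunk (eta a b : R) : set T := `]a + eta, b - eta[%classic.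

(** One value can serve all of [[a, b)] when the lower edge of the band at [b] is
    not above its upper edge at [a]; as each edge is [y = eps * eta] away from
    the distribution function of [mu], this bounds the mass in between by
    [2 * y]. *)
Definition bridgeable (eta a b : R) : bool :=
  (a <= b) && (mu (shrunk eta a b) <= (2 * (eps * eta))%:E)%E.

Lemma shrunk0 (eta a b : R) : b - eta <= a + eta -> shrunk eta a b = set0.
Proof.
move=> ba; apply/seteqP; split => // x.
by rewrite /shrunk/= in_itv/= => /andP[? ?]; lra.
Qed.

Lemma measurable_shrunk (eta a b : R) : measurable (shrunk eta a b).
Proof. exact: measurable_itv. Qed.
Hint Resolve measurable_shrunk : core.

Lemma shrunk_subset (eta a b c : R) : 0 < eta -> b - eta <= c ->
  shrunk eta a b `<=` `]a, c]%classic.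
Proof.
move=> ? ? x; rewrite /shrunk/= !in_itv/= => /andP[? ?].
by apply/andP; split; lra.
Qed.

(** Half-open cells match the convention of [step_on]: a breakpoint at [b]
    separates [b] from the points above it. *)
Lemma step_cell (a b : R) : (forall t, t \in ts -> ~~ (a < t < b)) ->
  forall x, `]a, b]%classic x -> g x = g b.
Proof.
move=> none x; rewrite /= in_itv/= => /andP[ax xb]; apply: gts => t /none abt.
apply/idP/idP => [xt|]; last exact: le_trans.
by move: abt; rewrite (lt_le_trans ax xt)/= -leNgt.
Qed.

Lemma splitoc (a b c : R) : a <= b -> b <= c ->
  `]a, c]%classic = (`]a, b] `|` `]b, c])%classic.
Proof.
move=> ab bc; apply/seteqP; split => x /=; rewrite !in_itv/=.
  by move=> /andP[ax xc]; have [xb|bx] := leP x b; [left|right]; apply/andP.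
by move=> [|] /andP[? ?]; apply/andP; split; lra.
Qed.

Lemma disjoc (a b c : R) : [disjoint `]a, b]%classic & `]b, c]%classic].
Proof.
rewrite disj_set2E; apply/eqP/seteqP; split => // x [] /=.
by rewrite !in_itv/= => /andP[? ?] /andP[? ?]; lra.
Qed.

Lemma weight_ocD (a b c : R) : a <= b -> b <= c ->
  weight_oc a c = (weight_oc a b + weight_oc b c)%E.
Proof.
move=> ab bc; rewrite /weight_oc (splitoc ab bc) ge0_integral_setU//.
- exact/measurable_EFinP/measurable_funTS.
- by move=> x _; rewrite lee_fin; case/andP: (w01 x).
- exact: disjoc.
Qed.

Lemma error_ocD (a b c : R) : a <= b -> b <= c ->
  error_oc a c = (error_oc a b + error_oc b c)%E.
Proof.
move=> ab bc; rewrite /error_oc (splitoc ab bc) approx_errorU//.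
exact: disjoc.
Qed.

Lemma weight_oc_ge0 (a b : R) : (0 <= weight_oc a b)%E.
Proof. by apply: integral_ge0 => x _; rewrite lee_fin; case/andP: (w01 x). Qed.

(** In a bridgeable cell the shrunken interior has mass at most [2 * (eps * eta)]
    by definition, and the rest has length at most [2 * eta]. *)
Lemma weight_oc_le (eta a b : R) : 0 < eta -> bridgeable eta a b ->
  (forall t, t \in ts -> ~~ (a < t < b)) ->
  (weight_oc a b <= (2 * (eps * eta))%:E + error_oc a b)%E.
Proof.
move=> eta0 /andP[ab mab] none.
apply: (cell_mass_le mw w01 balance mg _ _ _ _ (step_cell none) mab) => //.
  by apply: shrunk_subset => //; lra.
have [uv|vu] := leP (a + eta) (b - eta).
  rewrite /shrunk eps_lebesgueD//; [|lra|lra].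
  by rewrite lee_fin mulrCA ler_pM2l//; lra.
rewrite (shrunk0 (ltW vu)) setD0.
by rewrite (eps_lebesgue_itv false false)// lee_fin mulrCA ler_pM2l//; lra.
Qed.

(** Cutting a chain also at the breakpoints of [g] keeps its links bridgeable, as
    subintervals, and makes [g] constant on each of them; [pts] will be the list
    of atoms. *)
Lemma weight_oc_bound (pts : seq R) (eta a b : R) : 0 < eta ->
  (forall u v, u < v -> (forall t, t \in pts -> ~~ (u < t < v)) ->
    bridgeable eta u v) ->
  a < b ->
  (weight_oc a b <=
    ((size pts + size ts).+1%:R * (2 * (eps * eta)))%:E + error_oc a b)%E.
Proof.
move=> eta0 bridgeP ab; rewrite -size_cat; move: a b ab.
apply: (breakpoint_ind (Q := fun k a b => weight_oc a b <=
    (k%:R * (2 * (eps * eta)))%:E + error_oc a b)%E) =>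
  [a b ab none|m n a b c ab bc Qab Qbc|m n a b mn].
- rewrite mul1r; apply: weight_oc_le => //.
    by apply: bridgeP => // t tin; apply: none; rewrite mem_cat tin.
  by move=> t tin; apply: none; rewrite mem_cat tin orbT.
- rewrite (weight_ocD (ltW ab) (ltW bc)) (error_ocD (ltW ab) (ltW bc)).
  by rewrite natrD mulrDl EFinD [leRHS]addeACA; exact: leeD.
- move=> /le_trans; apply; rewrite leeD2r// lee_fin ler_wpM2r ?ler_nat//.
  by rewrite mulr_ge0// mulr_ge0 ?ltW.
Qed.

(** From [a], move right as long as the interval remains bridgeable.  All
    intervals but the last one then exhaust their allowance in mass and in
    length.  The gap between [eta0] and [eta] leaves room to stop slightly before
    the supremum, which avoids one-sided continuity of [mu] at that point. *)
Lemma greedy_cell (eta0 eta a b : R) : 0 < eta0 < eta -> a <= b ->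
  (forall t, t \in ts -> ~~ (a < t < b)) ->
  exists xs : seq R, [/\ path (bridgeable eta) a xs, last a xs = b &
    (((size xs)%:R * (2 * (eps * eta0)))%:E <=
      (2 * (eps * eta0))%:E + (weight_oc a b + error_oc a b))%E].
Proof.
move=> /andP[eta00 eta0eta].
set z := 2 * (eps * eta0); have z0 : 0 < z by rewrite !mulr_gt0.
have err0 u v : (0 <= error_oc u v)%E by exact: approx_error_ge0.
have z_le u v : (z%:E <= z%:E + (weight_oc u v + error_oc u v))%E.
  by rewrite leeDl// adde_ge0// weight_oc_ge0.
have [N] : exists N, b - a <= N%:R * (2 * eta0).
  exists (Num.truncn ((b - a) / (2 * eta0))).+1.
  by rewrite -ler_pdivrMr ?mulr_gt0// ltW// truncnS_gt.
elim: N a => [|N ihN] a baN ab none.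
  exists [::]; split => //=; first by rewrite mul0r in baN; lra.
  by rewrite mul0r (le_trans _ (z_le _ _))// lee_fin ltW.
have [gab|ngab] := boolP (bridgeable eta a b).
  by exists [:: b]; split => //=; rewrite ?gab// mul1r.
(* [x] is bridgeable from [a] and [x'] is not, with [x' <= x + s].  The bound
   [s <= eta] keeps [x' - eta] below [x], and [s <= 2 * (eta - eta0)] leaves
   length [2 * eta0] outside of the shrunken interior. *)
pose S := [set x | x <= b /\ bridgeable eta a x].
have Sa : S a.
  split => //; rewrite /bridgeable lexx/= shrunk0; last by lra.
  by rewrite measure0 lee_fin !mulr_ge0// ltW// (lt_trans eta00).
have supS : has_sup S by split; [exists a|exists b => x []].
pose s := Num.min eta (2 * (eta - eta0)).
have s0 : 0 < s by rewrite lt_min; apply/andP; split; lra.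
have [s1 s2] : s <= eta /\ s <= 2 * (eta - eta0).
  by rewrite /s !ge_min !lexx orbT.
have [x [xb gax] supx] := sup_adherent s0 supS.
pose x' := Num.min b (x + s).
have xb' : x < b.
  rewrite lt_neqAle xb andbT; apply/eqP => xE.
  by move: ngab; rewrite -xE gax.
have xx' : x < x' by rewrite lt_min xb'/=; lra.
have [x'b x's] : x' <= b /\ x' <= x + s.
  by rewrite /x' !ge_min !lexx orbT.
have ax : a <= x by case/andP: gax.
have ngx' : ~~ bridgeable eta a x'.
  rewrite /x'; case: (leP b (x + s)) => // xsb; apply/negP => gx'.
  have /(sup_upper_bound supS) : S (x + s) by split => //; exact: ltW.
  by lra.
have muV : ((2 * (eps * eta))%:E < mu (shrunk eta a x'))%E.
  move: ngx'; rewrite /bridgeable negb_and -!ltNge => /orP[|//].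
  by move=> ?; exfalso; lra.
have nonempty : a + eta < x' - eta.
  rewrite ltNge; apply/negP => le_; move: muV.
  rewrite shrunk0// measure0 lte_fin ltNge mulr_ge0// mulr_ge0// ?ltW//.
  exact: lt_trans eta0eta.
have none_ax t : t \in ts -> ~~ (a < t < x).
  by move=> /none; apply: contra => /andP[-> tx]; rewrite (lt_trans tx).
have cell : (z%:E <= weight_oc a x + error_oc a x)%E.
  have Vsub : shrunk eta a x' `<=` `]a, x]%classic.
    by apply: shrunk_subset; lra.
  apply: (le_cell_mass mw w01 balance mg _ _ Vsub _ (step_cell none_ax)) => //.
    apply: le_trans (ltW muV); rewrite lee_fin /z !ler_pM2l//; exact: ltW.
  rewrite /shrunk eps_lebesgueD; [|lra|lra|lra].
  by rewrite lee_fin /z mulrCA ler_pM2l//; lra.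
have [||xs [pxs lxs szxs]] := ihN x _ xb.
- by move: baN; rewrite -natr1 mulrDl mul1r; lra.
- by move=> t /none; apply: contra => /andP[xt ->]; rewrite (le_lt_trans ax).
exists (x :: xs); split => //=; first by rewrite gax.
rewrite -natr1 mulrDl mul1r EFinD (weight_ocD ax xb) (error_ocD ax xb).
rewrite (addeACA (weight_oc a x)) [leRHS]addeCA [leLHS]addeC.
exact: leeD.
Qed.

Lemma greedy (eta0 eta a b : R) : 0 < eta0 < eta -> a < b ->
  exists xs : seq R, [/\ path (bridgeable eta) a xs, last a xs = b &
    (((size xs)%:R * (2 * (eps * eta0)))%:E <=
      ((size ts).+1%:R * (2 * (eps * eta0)))%:E +
        (weight_oc a b + error_oc a b))%E].
Proof.
move=> eta0eta; have /andP[eta00 _] := eta0eta.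
set z := 2 * (eps * eta0); have z0 : 0 <= z by rewrite !mulr_ge0// ltW.
move: a b.
apply: (breakpoint_ind (Q := fun k a b => exists xs : seq R,
  [/\ path (bridgeable eta) a xs, last a xs = b &
    (((size xs)%:R * z)%:E <=
      (k%:R * z)%:E + (weight_oc a b + error_oc a b))%E])).
- move=> a b ab none; rewrite mul1r; apply: greedy_cell => //; exact: ltW.
- move=> m n a b c ab bc [xs [pxs lxs szxs]] [ys [pys lys szys]].
  exists (xs ++ ys); split.
  + by rewrite cat_path pxs lxs.
  + by rewrite last_cat lxs.
  rewrite (weight_ocD (ltW ab) (ltW bc)) (error_ocD (ltW ab) (ltW bc)).
  rewrite size_cat !natrD !mulrDl !EFinD (addeACA (weight_oc a b)).
  by rewrite [leRHS]addeACA; exact: leeD.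
- move=> m n a b mn [xs [pxs lxs szxs]]; exists xs; split => //.
  apply: le_trans szxs _; rewrite leeD2r// lee_fin ler_wpM2r ?ler_nat//.
Qed.

End Chains.

(** * Distribution functions and the Levy metric *)

Section DistributionFunctions.
Context {R : realType}.
Notation T := (measurableTypeR R).
Variable mu : probability T R.

Let mu_fin (A : set T) : measurable A -> mu A \is a fin_num.
Proof. by move=> mA; exact: fin_num_measure. Qed.

Lemma cdf_leftE (x : R) : mu `]-oo, x[%classic = (cdf_left mu x)%:E.
Proof. by rewrite /cdf_left fineK//; apply: mu_fin; exact: measurable_itv. Qed.

Lemma cdf_rightE (x : R) : mu `]-oo, x]%classic = (cdf_right mu x)%:E.
Proof. by rewrite /cdf_right fineK//; apply: mu_fin; exact: measurable_itv. Qed.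

Lemma le_cdf_right (x y : R) : x <= y -> cdf_right mu x <= cdf_right mu y.
Proof.
move=> xy; rewrite -lee_fin -!cdf_rightE; apply: le_measure;
  rewrite ?inE; [exact: measurable_itv..|].
by move=> z /=; rewrite !in_itv/=; lra.
Qed.

Lemma le_cdf_left (x y : R) : x <= y -> cdf_left mu x <= cdf_left mu y.
Proof.
move=> xy; rewrite -lee_fin -!cdf_leftE; apply: le_measure;
  rewrite ?inE; [exact: measurable_itv..|].
by move=> z /=; rewrite !in_itv/=; lra.
Qed.

Lemma cdf_left_right (x : R) : cdf_left mu x <= cdf_right mu x.
Proof.
rewrite -lee_fin -cdf_leftE -cdf_rightE; apply: le_measure;
  rewrite ?inE; [exact: measurable_itv..|].
by move=> z /=; rewrite !in_itv/=; lra.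
Qed.

Lemma cdf_right_ge0 (x : R) : 0 <= cdf_right mu x.
Proof. exact: fine_ge0. Qed.

Lemma cdf_right_le1 (x : R) : cdf_right mu x <= 1.
Proof.
by rewrite -lee_fin -cdf_rightE; apply: probability_le1; exact: measurable_itv.
Qed.

Lemma cdf_left_le1 (x : R) : cdf_left mu x <= 1.
Proof. exact: le_trans (cdf_left_right x) (cdf_right_le1 x). Qed.

(** Also valid when [v <= u], where both sides hold: this removes a case
    distinction each time an interval is shorter than [2 * eta]. *)
Lemma measure_oo_le (u v z : R) : 0 <= z ->
  (mu `]u, v[%classic <= z%:E)%E = (cdf_left mu v <= cdf_right mu u + z).
Proof.
move=> z0; have [uv|vu] := ltP u v; last first.
  rewrite [X in mu X](_ : _ = set0); last first.
    by apply/seteqP; split => // x; rewrite /= in_itv/= => /andP[? ?]; lra.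
  rewrite measure0 lee_fin z0; apply/esym/idP.
  by have := le_cdf_left vu; have := cdf_left_right u; lra.
have : mu `]-oo, v[%classic = (mu `]-oo, u]%classic + mu `]u, v[%classic)%E.
  rewrite -measureU//; [|exact: measurable_itv..|].
    congr (mu _); apply/seteqP; split => x /=; rewrite !in_itv/=.
      by move=> xv; have [xu|ux] := leP x u; [left|right].
    by move=> []; [lra|case/andP].
  by apply/seteqP; split => // x [] /=; rewrite !in_itv/= => ? /andP[? ?]; lra.
rewrite cdf_leftE cdf_rightE -(fineK (mu_fin (measurable_itv `]u, v[))).
by move=> [->]; rewrite !lee_fin lerD2l.
Qed.

End DistributionFunctions.

Section LevyBalls.
Context {R : realType}.
Notation T := (measurableTypeR R).
Variables (mu : probability T R) (eps : R).
Hypothesis heps : 0 < eps.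

(** The set whose infimum is [levy eps mu nu]. *)
Definition admissible (nu : probability T R) (y : R) := 0 < y /\
  forall x : R, cdf_left mu (x - y / eps) - y <= cdf_right nu x /\
                cdf_right nu x <= cdf_right mu (x + y / eps) + y.

Lemma levy_le (nu : probability T R) (y : R) :
  admissible nu y -> levy eps mu nu <= y.
Proof.
move=> adm; apply: ge_inf => //.
by exists 0 => z [z0 _]; exact: ltW.
Qed.

Lemma le_levy (nu : probability T R) (c : R) :
  (forall y, admissible nu y -> c <= y) -> c <= levy eps mu nu.
Proof.
move=> cy; apply: lb_le_inf => //; exists 1; split => // x; split.
- have := cdf_left_le1 mu (x - 1 / eps); have := cdf_right_ge0 nu x; lra.
- have := cdf_right_ge0 mu (x + 1 / eps); have := cdf_right_le1 nu x; lra.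
Qed.

Lemma levy_ge0 (nu : probability T R) : 0 <= levy eps mu nu.
Proof. by apply: le_levy => y [/ltW]. Qed.

Section Atoms.
Variables (n : nat) (x p : 'rV[R]_n) (hp : Pi p).

Lemma cdf_right_delta (t : R) : cdf_right (delta x hp) t =
  \sum_(j < n) p ord0 j * (x ord0 j <= t)%R%:R.
Proof.
rewrite /cdf_right -[RHS]/(fine _%:E) -sumEFin; congr fine.
apply: eq_bigr => j _; rewrite EFinM; congr (_ * _)%E.
by rewrite diracE mem_setE in_itv.
Qed.

(** Between two atoms the distribution function of [delta x hp] is constant on
    [[a, b)].  Passing from [y] to [y' > y] allows evaluating the lower edge of
    the band at a point [b'] strictly before [b], where that constant is still
    the value. *)
Lemma bridgeable_between_atoms (y y' a b : R) :
  admissible (delta x hp) y -> y < y' -> a < b ->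
  (forall j, ~~ (a < x ord0 j < b)) -> bridgeable mu eps (y' / eps) a b.
Proof.
move=> [y0 adm] yy' ab none; rewrite /bridgeable (ltW ab)/=.
have y'0 : 0 < y' by exact: lt_trans yy'.
have -> : eps * (y' / eps) = y' by rewrite mulrC divfK// gt_eqF.
have ee : y / eps < y' / eps by rewrite ltr_pM2r// invr_gt0.
have e0 : 0 < y / eps by rewrite divr_gt0.
have [ba|ba] := leP (b - y' / eps) (a + y' / eps).
  by rewrite shrunk0// measure0 lee_fin mulr_ge0// ltW.
rewrite /shrunk measure_oo_le; last by rewrite mulr_ge0// ltW.
pose b' := b - y' / eps + y / eps.
have [ab' b'b] : a < b' /\ b' < b by rewrite /b'; lra.
have FE : cdf_right (delta x hp) b' = cdf_right (delta x hp) a.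
  rewrite !cdf_right_delta; apply: eq_bigr => j _; congr (_ * _%:R).
  congr nat_of_bool; apply/idP/idP => [xb'|xa]; last exact: le_trans xa (ltW ab').
  by have := none j; rewrite (le_lt_trans xb' b'b) andbT -leNgt.
have [lo _] := adm b'; have [_ up] := adm a.
have := le_cdf_right mu (_ : a + y / eps <= a + y' / eps).
rewrite lerD2l => /(_ (ltW ee)).
by move: lo up; rewrite FE /b' addrK; lra.
Qed.

End Atoms.

(** Repeating the last point is harmless, so that a chain may be lengthened to any
    prescribed number of atoms. *)
Lemma path_bridgeable_pad (eta a b : R) (xs : seq R) (k : nat) : 0 < eta ->
  path (bridgeable mu eps eta) a xs -> last a xs = b ->
  path (bridgeable mu eps eta) a (xs ++ nseq k b) /\ last a (xs ++ nseq k b) = b.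
Proof.
move=> eta0 pxs lxs; rewrite cat_path last_cat pxs lxs/=.
elim: k => //= k [-> ->]; split => //; rewrite andbT /bridgeable lexx/=.
rewrite shrunk0; last by lra.
by rewrite measure0 lee_fin mulr_ge0// mulr_ge0// ltW.
Qed.

(** Put the atoms on the points of the chain and let the distribution function
    follow the upper edge of the band: after the atom at [t] it takes the value
    [H t = min 1 (F_mu (t + y / eps) + y)], the highest one allowed at [t].
    Bridgeability is what keeps this value above the lower edge up to the next
    atom; the tail conditions deal with the values [0] and [1] at the ends. *)
Lemma chain_atoms (y a b : R) (xs : seq R) : 0 < y ->
  path (bridgeable mu eps (y / eps)) a xs -> last a xs = b ->
  cdf_left mu (a - y / eps) <= y -> 1 - y <= cdf_right mu (b + y / eps) ->
  exists (x p : 'rV[R]_(size xs).+1) (hp : Pi p),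
    Xi x /\ admissible (delta x hp) y.
Proof.
move=> y0 pxs lxs lefta rightb; set eta := y / eps.
have eta0 : 0 < eta by rewrite divr_gt0.
have etaE : eps * eta = y by rewrite mulrC divfK// gt_eqF.
set n := (size xs).+1; pose s i := nth a (a :: xs) i.
have good_s i : (i.+1 < n)%N -> bridgeable mu eps eta (s i) (s i.+1).
  by move=> ilt; move/pathP: pxs => /(_ a i); exact.
have s_le i j : (i <= j)%N -> (j < n)%N -> s i <= s j.
  elim: j => [|j ihj]; first by rewrite leqn0 => /eqP ->.
  rewrite leq_eqVlt => /predU1P[->//|]; rewrite ltnS => ij jn.
  apply: le_trans (ihj ij (ltnW jn)) _.
  by have /andP[] := good_s _ jn.
pose H t := Num.min 1 (cdf_right mu (t + eta) + y).
have H_le t u : t <= u -> H t <= H u.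
  move=> tu; rewrite /H le_min !ge_min lexx/= lerD2r.
  by rewrite le_cdf_right ?orbT// lerD2r.
have H0 t : 0 <= H t.
  by rewrite /H le_min ler01/= addr_ge0 ?cdf_right_ge0// ltW.
have H1 t : H t <= 1 by rewrite /H ge_min lexx.
(* [U i] is the value of the distribution function after the first [i] atoms. *)
pose U i := if i is j.+1 then H (s j) else 0.
have sb : s n.-1 = b by rewrite /s /n/= (last_nth a) in lxs *.
have Ub : U n = 1.
  apply/eqP; rewrite eq_le H1/= -/n sb /H le_min lexx/=.
  by move: rightb; rewrite -/eta; lra.
pose x : 'rV[R]_n := \row_j s j; pose p : 'rV[R]_n := \row_j (U j.+1 - U j).
have hp : Pi p.
  split.
    move=> j; rewrite mxE subr_ge0; case: j => -[|j] jn //=.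
    by apply: H_le; apply: s_le.
  under eq_bigr do rewrite mxE.
  by rewrite -(big_mkord xpredT (fun j => U j.+1 - U j)) telescope_sumr// Ub subr0.
exists x, p, hp; split.
  by move=> i j ij; rewrite !mxE; apply: s_le.
split => // t; rewrite cdf_right_delta -/eta.
under eq_bigr do rewrite !mxE.
rewrite -(big_mkord xpredT (fun j => (U j.+1 - U j) * (s j <= t)%R%:R)).
have [ta|at_] := ltP t a.
  rewrite big_nat big1 => [|i /andP[_ ilt]]; last first.
    by rewrite leNgt (lt_le_trans ta) ?mulr0//; exact: (s_le 0%N).
  split; last by rewrite addr_ge0 ?cdf_right_ge0// ltW.
  have := @le_cdf_left _ mu (t - eta) (a - eta); rewrite lerD2r => /(_ (ltW ta)).
  by move: lefta; rewrite -/eta; lra.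
(* [k] is the index of the last atom at or before [t]. *)
pose P i := (i < n)%N && (s i <= t).
have exP : exists i, P i by exists 0%N; rewrite /P.
have ubP i : P i -> (i <= n)%N by case/andP => /ltnW.
case: (ex_maxnP exP ubP) => k /andP[kn skt] kmax.
have -> : \sum_(0 <= i < n) (U i.+1 - U i) * (s i <= t)%R%:R = H (s k).
  rewrite (big_cat_nat (n := k.+1))//= [X in _ + X]big_nat.
  rewrite [X in _ + X]big1 ?addr0; last first.
    move=> i /andP[ki ilt]; rewrite (_ : (_ <= t) = false) ?mulr0//.
    by apply/negP => sit; have := kmax i; rewrite /P ilt sit => /(_ isT); lia.
  rewrite big_nat (eq_bigr (fun i => U i.+1 - U i)) => [|i /andP[_ ik]].
    by rewrite -big_nat telescope_sumr// subr0.
  by rewrite (le_trans _ skt) ?mulr1//; exact: s_le.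
split; last first.
  rewrite /H ge_min; apply/orP; right; rewrite lerD2r.
  by apply: le_cdf_right; rewrite lerD2r.
have [k1n|k1n] := ltnP k.+1 n; last first.
  have -> : k = n.-1 by lia.
  move: Ub; rewrite /U/= -/n => ->.
  by have := cdf_left_le1 mu (t - eta); lra.
have ts : t < s k.+1.
  rewrite ltNge; apply/negP => sit.
  by have := kmax k.+1; rewrite /P k1n sit => /(_ isT); lia.
rewrite /H le_min; apply/andP; split.
  by have := cdf_left_le1 mu (t - eta); lra.
have /andP[_] := good_s _ k1n; rewrite /shrunk measure_oo_le; last first.
  by rewrite etaE mulr_ge0// ltW.
rewrite etaE => gk.
have := @le_cdf_left _ mu (t - eta) (s k.+1 - eta); rewrite lerD2r => /(_ (ltW ts)).
lra.
Qed.

End LevyBalls.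

(** * The asymptotic number of atoms *)

Section Asymptotics.
Context {R : realType}.
Notation T := (measurableTypeR R).
Variables (mu : probability T R) (eps : R) (heps : 0 < eps) (w : T -> R).
Hypothesis mw : measurable_fun setT w.
Hypothesis w01 : forall x, 0 <= w x <= 1.
Hypothesis balance : forall B : set T, measurable B ->
  (\int[mu]_(x in B) (w x)%:E =
   \int[eps_lebesgue heps]_(x in B) (1 - w x)%:E)%E.
Variable nu : nat -> probability T R.
Hypothesis hnu : forall n : nat, (0 < n)%N -> best_approx eps mu n (nu n).

Let W : R := fine (\int[mu]_x (w x)%:E).
Let d n : R := levy eps mu (nu n).

Let mw' (B : set T) : measurable_fun B (fun x => (w x)%:E).
Proof. exact/measurable_EFinP/measurable_funTS. Qed.

Let w0 x : (0 <= (w x)%:E)%E.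
Proof. by rewrite lee_fin; case/andP: (w01 x). Qed.

Lemma weight_le (B : set T) : measurable B ->
  (\int[mu]_(x in B) (w x)%:E <= mu B)%E.
Proof.
move=> mB; rewrite -[leRHS]mul1e -integral_cst//.
by apply: ge0_le_integral => // x _; rewrite lee_fin; case/andP: (w01 x).
Qed.

Lemma total_weightE : (\int[mu]_x (w x)%:E = W%:E)%E.
Proof.
rewrite fineK// ge0_fin_numE; last exact: integral_ge0.
apply: le_lt_trans (weight_le measurableT) _.
by rewrite probability_setT ltry.
Qed.

Lemma total_weight_ge0 : 0 <= W.
Proof. by apply: fine_ge0; exact: integral_ge0. Qed.

(** [n] atoms and [size ts] breakpoints cut a large interval into
    [n + size ts + 1] bridgeable cells, none of which carries much more than
    [2 * y] of the total weight [W]. *)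
Lemma atoms_lower_bound (del : R) : 0 < del ->
  exists K : nat, forall n, (0 < n)%N -> W - del <= 2 * (n + K)%:R * d n.
Proof.
move=> del0; have del20 : 0 < del / 2 by rewrite divr_gt0.
have [ts [g [gts mg g01 gd]]] :=
  step_approximation (eps_lebesgue_fin heps) mw w01 balance del20.
have [M [M0 tail]] := probability_tail mu del20.
have MM : - M < M by lra.
exists (size ts).+1 => n n0; have [x [p [hp [_ nuE _]]]] := hnu n0.
rewrite /d nuE; set L : R := 2 * _.
have L0 : 0 < L by rewrite /L mulr_gt0// ltr0n addnS.
rewrite mulrC -ler_pdivrMr//.
apply: le_levy => y adm; rewrite leNgt; apply/negP => yc.
have [y0 _] := adm.
(* Strictly between [y] and the claimed bound, as [bridgeable_between_atoms]
   needs some room above [y]. *)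
pose y' := (y + (W - del) / L) / 2.
have [yy' y'c] : y < y' /\ y' < (W - del) / L by rewrite /y'; lra.
have eta0 : 0 < y' / eps by rewrite divr_gt0// (lt_trans y0).
have bridgeP u v : u < v ->
    (forall t, t \in [seq x ord0 j | j <- enum 'I_n] -> ~~ (u < t < v)) ->
    bridgeable mu eps (y' / eps) u v.
  move=> uv none; apply: (bridgeable_between_atoms heps adm yy' uv) => j.
  by apply: none; apply/mapP; exists j => //; rewrite mem_enum.
have := weight_oc_bound mw w01 balance gts mg g01 eta0 bridgeP MM.
rewrite size_map size_enum_ord -addnS.
have -> : eps * (y' / eps) = y' by rewrite mulrC divfK// gt_eqF.
have weightW : (W%:E <= weight_oc mu w (- M) M + (del / 2)%:E)%E.
  rewrite -total_weightE -(setUv `]- M, M]%classic) ge0_integral_setU//.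
  - by apply: leeD => //; apply: le_trans tail; apply: weight_le;
      exact: measurableC.
  - exact: measurableC.
  - by rewrite disj_set2E setICr.
have errW : (error_oc mu heps w g (- M) M <= (del / 2)%:E)%E.
  by apply: le_trans gd; exact: le_approx_error.
move=> bound; have : (W%:E <= (L * y')%:E + del%:E)%E.
  rewrite [del]splitr EFinD; apply: le_trans weightW _.
  rewrite addeA; apply: leeD => //; apply: le_trans bound _.
  by apply: leeD => //; rewrite lee_fin /L; lra.
rewrite -EFinD lee_fin; move: y'c; rewrite ltr_pdivlMr//; lra.
Qed.

(** For [y > y0 = (W + del) / (2 * (n - K))] the greedy chain across an interval
    with tails of mass at most [y] has at most [n] points, hence yields [n] atoms
    within distance [y]. *)
Lemma atoms_upper_bound (del : R) : 0 < del ->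
  exists K : nat, forall n, (K < n)%N -> 2 * (n%:R - K%:R) * d n <= W + del.
Proof.
move=> del0.
have [ts [g [gts mg g01 gd]]] :=
  step_approximation (eps_lebesgue_fin heps) mw w01 balance del0.
(* One more than the [size ts + 1] links lost to the breakpoints, because a chain
   with [size xs] links has [size xs + 1] points. *)
exists (size ts).+2 => n Kn; set K := (size ts).+2 in Kn *.
have nK0 : 0 < n%:R - K%:R :> R by rewrite subr_gt0 ltr_nat.
set L : R := 2 * _; have L0 : 0 < L by rewrite /L mulr_gt0.
have Wd0 : 0 < W + del by have := total_weight_ge0; lra.
rewrite mulrC -ler_pdivlMr//; set y0 := (W + del) / L.
have y00 : 0 < y0 by rewrite divr_gt0.
rewrite leNgt; apply/negP => dy.
pose y := (y0 + d n) / 2.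
have [y0y yd] : y0 < y /\ y < d n by rewrite /y; lra.
have yp : 0 < y by exact: lt_trans y0y.
have etas : 0 < y0 / eps < y / eps.
  by rewrite divr_gt0//= ltr_pM2r// invr_gt0.
have [M [M0 tail]] := probability_tail mu yp.
have MM : - M < M by lra.
have [xs [pxs lxs szxs]] := greedy mw w01 balance gts mg g01 etas MM.
have etaE z : eps * (z / eps) = z by rewrite mulrC divfK// gt_eqF.
have eta0 : 0 < y / eps by rewrite divr_gt0.
have weightW : (weight_oc mu w (- M) M <= W%:E)%E.
  by rewrite -total_weightE; exact: ge0_subset_integral.
have errW : (error_oc mu heps w g (- M) M <= del%:E)%E.
  by apply: le_trans gd; exact: le_approx_error.
have szn : (size xs < n)%N.
  have : (((size xs)%:R * (2 * y0))%:E <=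
      (((size ts).+1%:R * (2 * y0))%:E + (W%:E + del%:E)))%E.
    by move: szxs; rewrite etaE => /le_trans; apply; rewrite leeD2l// leeD.
  have -> : W%:E + del%:E = ((n%:R - K%:R) * (2 * y0))%:E :> \bar R.
    by rewrite -EFinD; congr EFin; rewrite /y0 /L; field; rewrite gt_eqF.
  have y02 : 0 < 2 * y0 by lra.
  rewrite -EFinD lee_fin -mulrDl ler_pM2r//.
  rewrite /K -(natr1 (size ts).+1) => szxs'.
  by rewrite -(ltr_nat R); lra.
have [pys lys] := path_bridgeable_pad heps (n - (size xs).+1) eta0 pxs lxs.
set ys := xs ++ _ in pys lys.
have nE : (size ys).+1 = n by rewrite /ys size_cat size_nseq -addSn (subnKC szn).
have [||x [p [hp [Xix adm]]]] := chain_atoms heps yp pys lys.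
- rewrite -lee_fin -cdf_leftE; apply: le_trans tail.
  apply: le_measure; rewrite ?inE; [exact: measurable_itv| |].
    by apply: measurableC; exact: measurable_itv.
  move=> z; rewrite /= !in_itv/= => zM; apply/negP; rewrite negb_and -leNgt.
  by apply/orP; left; lra.
- have : (mu (~` `]-oo, (M + y / eps)%R]%classic) <= y%:E)%E.
    apply: le_trans tail; apply: le_measure; rewrite ?inE.
    + by apply: measurableC; exact: measurable_itv.
    + by apply: measurableC; exact: measurable_itv.
    apply: subsetC => z; rewrite /= !in_itv/= => /andP[_ zM]; lra.
  rewrite probability_setC; last exact: measurable_itv.
  by rewrite cdf_rightE -EFinB lee_fin; lra.
move: x p hp Xix adm; rewrite nE => x p hp Xix adm.
have n0 : (0 < n)%N by rewrite -nE.
have [_ [_ [_ [_ _ /(_ x p hp Xix) best]]]] := hnu n0.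
by have := le_lt_trans (le_trans best (levy_le adm)) yd; rewrite ltxx.
Qed.

(** Both bounds are off by a multiple of [d n], and the upper one shows that
    [d n] tends to [0]. *)
Lemma n_levy_cvg : (n%:R * d n) @[n --> \oo] --> W / 2.
Proof.
apply/cvgrPdist_le => e e0.
have [K1 low] := atoms_lower_bound e0.
have [K2 up] := atoms_upper_bound e0.
pose N := (K2 + (Num.truncn ((K1 + K2)%:R * (W + e) / e)).+1)%N.
exists N => // n /= Nn.
have KN : (K2 < n)%N by apply: leq_trans Nn; rewrite /N addnS ltnS leq_addr.
have n0 : (0 < n)%N by exact: leq_ltn_trans KN.
have /(_ n0) lown := low n; have /(_ KN) upn := up n.
have d0 : 0 <= d n by exact: (levy_ge0 mu eps).
have small : (K1 + K2)%:R * d n <= e / 2.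
  have nK : (K1 + K2)%:R * (W + e) / e <= n%:R - K2%:R.
    rewrite (le_trans (ltW (truncnS_gt _)))// lerBrDl -natrD ler_nat.
    exact: Nn.
  have nK0 : 0 < n%:R - K2%:R :> R by rewrite subr_gt0 ltr_nat.
  rewrite -(ler_pM2l nK0); move: nK; rewrite ler_pdivrMr// => nK.
  have k0 : 0 <= (K1 + K2)%:R :> R by exact: ler0n.
  have := ler_wpM2l k0 upn; nra.
have K1d : K1%:R * d n <= e / 2.
  by apply: le_trans small; rewrite natrD mulrDl lerDl mulr_ge0.
have K2d : K2%:R * d n <= e / 2.
  by apply: le_trans small; rewrite natrD mulrDl lerDr mulr_ge0.
move: lown; rewrite natrD => lown.
by rewrite ler_norml; apply/andP; split; lra.
Qed.

End Asymptotics.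

(** * The weight given by the Lebesgue decomposition *)

Lemma measurable_Omega (R : realType) : measurable_fun setT (@Omega R).
Proof.
apply: continuous_measurable_fun => x; apply: cvgM; first exact: cvg_id.
apply: cvgV; first by rewrite gt_eqF// ltr_wpDr// mulr_ge0.
apply: cvgD; first exact: cvg_cst.
by apply: cvgM; [exact: cvg_cst|exact: norm_continuous].
Qed.

Lemma Omega_bounds (R : realType) (x : R) : 0 <= x -> 0 <= Omega x <= 2^-1.
Proof.
move=> x0; rewrite /Omega ger0_norm//.
have D : 0 < 2 + 2 * x by rewrite ltr_wpDr// mulr_ge0.
rewrite divr_ge0 ?(ltW D)//= ler_pdivrMr//.
by rewrite mulrDr !mulrA mulVf// mul1r lerDr.
Qed.

Section Decomposition.
Context {R : realType}.
Notation T := (measurableTypeR R).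
Variables (mu : probability T R) (eps : R) (heps : 0 < eps).
Variables (muA muS : {finite_measure set T -> \bar R}).
Hypothesis hdec : lebesgue_decomposition mu muA muS.

Notation leb := (@lebesgue_measure R).
Notation RN := ('d (charge_of_finite_measure muA) '/d leb).

(** With [q = Omega (f / eps)] one has [1 - 2 * q = eps / (eps + f)], hence
    [(1 - 2 * q) * f = eps * (2 * q)] ([qr] below), which is the balance equation
    for the absolutely continuous part.  On the null set [N] carrying the singular
    part the weight is [0], so that the singular part does not contribute. *)
Lemma exists_balanced_weight : exists w : T -> R,
  [/\ measurable_fun setT w, forall x, 0 <= w x <= 1,
      forall B : set T, measurable B ->
        (\int[mu]_(x in B) (w x)%:E =
         \int[eps_lebesgue heps]_(x in B) (1 - w x)%:E)%E &
      (\int[leb]_x (Omega (eps^-1 * fine (RN x)))%:E =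
       2^-1%:E * \int[leb]_x (1 - w x)%:E)%E].
Proof.
have [muE domA [N [mN muSN lebN]]] := hdec.
(* A version of the density that is nonnegative everywhere; it agrees with [RN]
   almost everywhere. *)
pose f := Radon_Nikodym_SigmaFinite.f muA leb.
have f0 x : (0 <= f x)%E by exact: Radon_Nikodym_SigmaFinite.f_ge0.
have ffin x : f x \is a fin_num by exact: Radon_Nikodym_SigmaFinite.f_fin_num.
have mf : measurable_fun setT f.
  exact: measurable_int (Radon_Nikodym_SigmaFinite.f_integrable _).
pose r x := fine (f x); have r0 x : 0 <= r x by exact: fine_ge0.
have mr : measurable_fun setT r by exact: measurableT_comp.
pose q x := Omega (eps^-1 * r x).
have mq : measurable_fun setT q.
  apply: measurableT_comp; first exact: measurable_Omega.
  exact: measurable_funM.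
have q01 x : 0 <= q x <= 2^-1.
  by apply: Omega_bounds; rewrite mulr_ge0// invr_ge0 ltW.
have qr x : (1 - 2 * q x) * r x = eps * (2 * q x).
  have D : eps + r x != 0 by rewrite gt_eqF// ltr_wpDr.
  have D' : 2 + 2 * (eps^-1 * r x) != 0.
    by rewrite gt_eqF// ltr_wpDr// !mulr_ge0// invr_ge0 ltW.
  rewrite /q /Omega ger0_norm; last by rewrite mulr_ge0// invr_ge0 ltW.
  have e0 : eps != 0 by rewrite gt_eqF.
  by field; rewrite e0 -mulrDr mulf_neq0//=.
pose w (x : T) : R := if x \in N then 0 else 1 - 2 * q x.
have mw : measurable_fun setT w.
  apply: measurable_fun_ifT => //.
    apply: (measurable_fun_bool true).
    by rewrite setTI (_ : _ @^-1` _ = N)//; apply/seteqP; split => x;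
      [exact: set_mem|exact: mem_set].
  by apply: measurable_funB => //; exact: measurable_funM.
have w01 x : 0 <= w x <= 1.
  rewrite /w; case: ifP => _; first by rewrite lexx ler01.
  by have := q01 x; lra.
have mw' (B : set T) : measurable_fun B (fun x => (w x)%:E).
  exact/measurable_EFinP/measurable_funTS.
have mw1 (B : set T) : measurable_fun B (fun x => (1 - w x)%:E).
  by apply/measurable_EFinP/measurable_funTS; exact: measurable_funB.
have w0 x : (0 <= (w x)%:E)%E by rewrite lee_fin; case/andP: (w01 x).
have w1 x : (0 <= (1 - w x)%:E)%E.
  by rewrite lee_fin subr_ge0; case/andP: (w01 x).
exists w; split => //.
- move=> B mB.
  rewrite (eq_measure_integral (measure_add muA muS)); last first.
    by move=> A mA _; exact: etrans (muE A mA) (esym (measure_addE muA muS A)).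
  rewrite ge0_integral_measure_add//.
  rewrite [X in (_ + X)%E](_ : _ = 0%E) ?adde0; last first.
    rewrite (ge0_negligible_integral (measurableC mN))// setDE setCK.
    by apply: integral0_eq => x [_ Nx]; rewrite /w mem_set.
  rewrite -(Radon_Nikodym_SigmaFinite.change_of_variables domA)//.
  rewrite ge0_integral_mscale//.
  rewrite [X in (_ * X)%E](ge0_negligible_integral mN)//.
  rewrite [LHS](ge0_negligible_integral mN)//; last 2 first.
  - by apply: emeasurable_funM => //; exact: measurable_funTS.
  - by move=> x _; rewrite mule_ge0.
  have mBN : measurable (B `\` N) by exact: measurableD.
  rewrite -ge0_integralZl_EFin//=; last exact: ltW.
  apply: eq_integral => x; rewrite inE => -[_ Nx].
  rewrite -/(f x) -(fineK (ffin x)) -!EFinM; congr EFin.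
  by rewrite /w memNset// -/(r x) qr; ring.
- have mO : measurable_fun setT (fun x => (Omega (eps^-1 * fine (RN x)))%:E).
    apply/measurable_EFinP; apply: measurableT_comp.
      exact: measurable_Omega.
    apply: measurable_funM => //; apply: measurableT_comp => //.
  rewrite -ge0_integralZl_EFin//.
  apply: ae_eq_integral => //; first exact: measurable_funeM.
  have aeN : {ae leb, forall x, ~ N x}.
    by exists N; split => // x /contrapT.
  have := ae_eq_Radon_Nikodym_SigmaFinite domA measurableT.
  apply: filterS2 aeN => x Nx /(_ I) fRN _ /=.
  rewrite -fRN -/(f x) -/(r x) -/(q x) /w memNset// -EFinM; congr EFin.
  by field.
Qed.

End Decomposition.

Theorem proposition4p3 (R : realType)
  (mu : probability (measurableTypeR R) R) (eps : R) (heps : 0 < eps)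
  (muA muS : {finite_measure set (measurableTypeR R) -> \bar R})
  (hdec : lebesgue_decomposition mu muA muS)
  (nu : nat -> probability (measurableTypeR R) R)
  (hnu : forall n : nat, (0 < n)%N -> best_approx eps mu n (nu n)) :
  (n%:R * levy eps mu (nu n))%:E @[n --> \oo] -->
  (eps%:E * \int[lebesgue_measure]_x
     (Omega (eps^-1 * fine (('d (charge_of_finite_measure muA) '/d lebesgue_measure) x)))%:E)%E.
Proof.
have [w [mw w01 balance ->]] := exists_balanced_weight heps hdec.
have scaled : (\int[eps_lebesgue heps]_x (1 - w x)%:E =
    eps%:E * \int[lebesgue_measure]_x (1 - w x)%:E)%E.
  rewrite ge0_integral_mscale//.
  - by apply/measurable_EFinP; exact: measurable_funB.
  - by move=> x _; rewrite lee_fin subr_ge0; case/andP: (w01 x).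
rewrite muleCA -scaled -balance// (total_weightE mu mw w01) -EFinM mulrC.
apply: cvg_EFin; first exact: nearW.
have cvg_levy := n_levy_cvg mw w01 balance hnu.
exact: cvg_levy.
Qed.
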